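(* Let $(\mathbb{E},\circ,\bullet)$ be a Euclidean Jordan algebra of dimension $n$ and rank $\mathrm{rk}$, let $\mathfrak{F}_{\rm c}(\mathbb{E})$ be a complete set of representatives of the $\mathfrak{S}_{\mathrm{rk}}$-orbits in $\mathfrak{F}(\mathbb{E})$, and fix a set $\mathfrak{F}$ with $\mathfrak{F}_{\rm c}(\mathbb{E})\subseteq\mathfrak{F}\subseteq\mathfrak{F}(\mathbb{E})$. For $r\in\mathbb{N}$ let $$\mathcal{I}_{{\rm dP},r}^{n}(\mathbb{E}_+)=\bigcap_{(c_1,\dots,c_{\mathrm{rk}})\in\mathfrak{F}}\{\mathcal{A}\in\mathcal{S}^{n,2}(\mathbb{E})\mid\mathcal{A}(c_1,\dots,c_{\mathrm{rk}})\in\mathcal{I}_{{\rm dP},r}^{\mathrm{rk}}\}.$$ Then each $\mathcal{I}_{{\rm dP},r}^{n}(\mathbb{E}_+)$ is a closed convex cone, $\mathcal{I}_{{\rm dP},r}^{n}(\mathbb{E}_+)\subseteq\mathcal{I}_{{\rm dP},r+1}^{n}(\mathbb{E}_+)\subseteq\mathcal{COP}^{n,2}(\mathbb{E}_+)$ for all $r\in\mathbb{N}$, and $\operatorname{int}\mathcal{COP}^{n,2}(\mathbb{E}_+)\subseteq\bigcup_{r=0}^\infty\mathcal{I}_{{\rm dP},r}^{n}(\mathbb{E}_+)$.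
   Context: $\mathbb{N}$ is the set of nonnegative integers. A Euclidean Jordan algebra $(\mathbb{E},\circ,\bullet)$ is a finite-dimensional real vector space with a bilinear product $\circ$ such that $x\circ y=y\circ x$ and $x\circ((x\circ x)\circ y)=(x\circ x)\circ(x\circ y)$, having an identity element $e$ for $\circ$, together with a fixed inner product $\bullet$ satisfying $(x\circ y)\bullet z=x\bullet(y\circ z)$. Its symmetric cone is $\mathbb{E}_+=\{x\circ x\mid x\in\mathbb{E}\}$. An idempotent ($c\circ c=c$) is primitive if it is nonzero and not the sum of two nonzero idempotents. A Jordan frame is a system $c_1,\dots,c_k$ of primitive idempotents with $c_i\circ c_j=0$ for $i\ne j$ and $\sum_i c_i=e$; every Jordan frame has exactly $\mathrm{rk}$ elements ($\mathrm{rk}$ is the rank). $\mathfrak{F}(\mathbb{E})$ is the set of ordered Jordan frames $(c_1,\dots,c_{\mathrm{rk}})$; the symmetric group $\mathfrak{S}_{\mathrm{rk}}$ acts on it by $\sigma\cdot(c_1,\dots,c_{\mathrm{rk}})=(c_{\sigma(1)},\dots,c_{\sigma(\mathrm{rk})})$. $\mathcal{S}^{n,2}(\mathbb{E})$ is the space of symmetric tensors of order 2 over $\mathbb{E}$ with inner product induced by $\langle x_1\otimes x_2,y_1\otimes y_2\rangle=(x_1\bullet y_1)(x_2\bullet y_2)$. $\mathcal{COP}^{n,2}(\mathbb{E}_+)=\{\mathcal{A}\in\mathcal{S}^{n,2}(\mathbb{E})\mid\langle\mathcal{A},x\otimes x\rangle\ge0\ \forall x\in\mathbb{E}_+\}$.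 For $\mathcal{A}\in\mathcal{S}^{n,2}(\mathbb{E})$ and an ordered Jordan frame, $\mathcal{A}(c_1,\dots,c_{\mathrm{rk}})$ is the symmetric $\mathrm{rk}\times\mathrm{rk}$ matrix with $(i,j)$th element $\langle\mathcal{A},c_i\otimes c_j\rangle$. $\mathcal{I}_{{\rm dP},r}^{\mathrm{rk}}$ is the set of symmetric real $\mathrm{rk}\times\mathrm{rk}$ matrices $\boldsymbol{A}$ such that the polynomial $(x_1+\cdots+x_{\mathrm{rk}})^r\,\boldsymbol{x}^\top\boldsymbol{A}\boldsymbol{x}$ in $x_1,\dots,x_{\mathrm{rk}}$ has only nonnegative coefficients. A cone is a nonempty set closed under multiplication by positive scalars. *)

(* Defs.v *)
From HB Require Import structures.
From mathcomp Require Import all_boot all_order all_algebra all_fingroup.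
From mathcomp Require Import sesquilinear ring.
From mathcomp Require Import all_classical all_reals all_analysis.
(* The notations of mpoly clash with those of mathcomp-analysis. *)
From mathcomp Require Import -(notations) mpoly.

Set Implicit Arguments.
Unset Strict Implicit.
Unset Printing Implicit Defensive.

Import Order.TTheory GRing.Theory Num.Theory.
Import numFieldNormedType.Exports.

Local Open Scope classical_set_scope.
Local Open Scope ring_scope.

(* A dot product [{dot E for idfun}] is a symmetric positive definite bilinear
   form. The zero algebra is allowed. *)
Record euclideanJordan (R : realType) (E : vectType R) := EuclideanJordan {
  jmul : {bilinear E -> E -> E} ;
  jdot : {dot E for @idfun R} ;
  jone : E ;
  jmulC : forall x y, jmul x y = jmul y x ;
  jordan_identity : forall x y,
    jmul x (jmul (jmul x x) y) = jmul (jmul x x) (jmul x y) ;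
  jmul1l : forall x, jmul jone x = x ;
  jdot_assoc : forall x y z, jdot (jmul x y) z = jdot x (jmul y z) }.

Section Jordan.
Variables (R : realType) (E : vectType R) (J : euclideanJordan E).
Local Notation "x 'o* y" := (jmul J x y) (at level 40, left associativity).
Local Notation e := (jone J).

Definition symcone : set E := [set x 'o* x | x in [set: E]].

Definition idempotent_elt (c : E) : Prop := c 'o* c = c.

Definition primitive_idempotent (c : E) : Prop :=
  [/\ idempotent_elt c, c != 0
    & ~ exists a b : E, [/\ idempotent_elt a, idempotent_elt b,
                            a != 0, b != 0 & c = a + b]].

Definition jordan_frame (k : nat) (c : 'I_k -> E) : Prop :=
  [/\ forall i, primitive_idempotent (c i),
      forall i j, i != j -> c i 'o* c j = 0
    & \sum_i c i = e].

Fixpoint jpow (x : E) (k : nat) : E :=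
  if k is k'.+1 then x 'o* jpow x k' else e.

Lemma jdegree_subproof (x : E) :
  exists k, ~~ free [seq jpow x i | i <- iota 0 k.+1].
Proof.
exists (\dim {:E}); apply/negP => /eqP fX.
have := dimvS (subvf <<[seq jpow x i | i <- iota 0 (\dim {:E}).+1]>>).
by rewrite fX size_map size_iota ltnn.
Qed.

(* The degree of the minimal polynomial of x: the least k such that
   e, x, ..., x^k are linearly dependent. *)
Definition jdegree (x : E) : nat := ex_minn (jdegree_subproof x).

Lemma jdegree_le_dim (x : E) : (jdegree x <= \dim {:E})%N.
Proof.
rewrite /jdegree; case: ex_minnP => k _; apply; apply/negP => /eqP fX.
have := dimvS (subvf <<[seq jpow x i | i <- iota 0 (\dim {:E}).+1]>>).
by rewrite fX size_map size_iota ltnn.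
Qed.

Lemma jrank_subproof : exists k, `[< exists x, jdegree x = k >].
Proof. by exists (jdegree 0); apply/asboolP; exists 0. Qed.

Lemma jrank_bound k : `[< exists x, jdegree x = k >] -> (k <= \dim {:E})%N.
Proof. by move=> /asboolP[x <-]; exact: jdegree_le_dim. Qed.

(* The rank is the largest degree of a minimal polynomial. *)
Definition jrank : nat := ex_maxn jrank_subproof jrank_bound.

Definition ordered_frames : set ('I_jrank -> E) := [set c | jordan_frame c].

Definition same_orbit (c c' : 'I_jrank -> E) : Prop :=
  exists s : 'S_jrank, c' = c \o s.

Definition complete_representatives (Fc : set ('I_jrank -> E)) : Prop :=
  Fc `<=` ordered_frames /\
  forall c, ordered_frames c -> exists! c', Fc c' /\ same_orbit c c'.

End Jordan.

Arguments ordered_frames {R E} J _.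
Arguments complete_representatives {R E} J Fc.

(* Symmetric matrices as a vector space, with the topology induced by that of
   'M[R]_n. *)
Section SymmetricMatrices.
Variables (R : realType) (n : nat).

Definition symmx_pred : {pred 'M[R]_n} := fun A => A^T == A.

Lemma symmx_submod_closed : submod_closed symmx_pred.
Proof.
split=> [|a A B]; rewrite !unfold_in ?linear0//.
by move=> /eqP hA /eqP hB; rewrite linearP/= hA hB.
Qed.

HB.instance Definition _ :=
  GRing.isSubmodClosed.Build R 'M[R]_n symmx_pred symmx_submod_closed.

Record symmx := SymMx { symmx_val :> 'M[R]_n ; _ : symmx_val \in symmx_pred }.

HB.instance Definition _ := [isSub of symmx for symmx_val].
HB.instance Definition _ := [Choice of symmx by <:].
HB.instance Definition _ := [SubChoice_isSubLmodule of symmx by <:].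
HB.instance Definition _ :=
  Topological.copy symmx (initial_topology symmx_val).

End SymmetricMatrices.

(* The tensor square of E is modelled by the matrices of coordinates in the
   basis (b_i (x) b_j), where b is the basis [vbasis {:E}] of E. *)
Section Tensors.
Variables (R : realType) (E : vectType R) (J : euclideanJordan E).
Local Notation n := (\dim {:E}).
Local Notation b := (vbasis {:E}).

Definition tens (x y : E) : 'M[R]_n :=
  \matrix_(i, j) (coord b i x * coord b j y).

(* The bilinear extension of
   <b_i (x) b_j, b_k (x) b_l> = (b_i . b_k) (b_j . b_l); the basis b is not
   assumed to be orthonormal. *)
Definition tdot (A B : 'M[R]_n) : R :=
  \sum_i \sum_j \sum_k \sum_l
     A i j * B k l * (jdot J b`_i b`_k * jdot J b`_j b`_l).

Lemma jdot_coord (x y : E) :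
  jdot J x y = \sum_i \sum_k coord b i x * coord b k y * jdot J b`_i b`_k.
Proof.
rewrite {1}(coord_vbasis (memvf x)) {1}(coord_vbasis (memvf y)).
rewrite linear_sumlz; apply: eq_bigr => i _.
rewrite linear_sumr; apply: eq_bigr => k _.
by rewrite linearZl_LR linearZr_LR/= mulrA.
Qed.

Lemma tdot_tens (x1 x2 y1 y2 : E) :
  tdot (tens x1 x2) (tens y1 y2) = jdot J x1 y1 * jdot J x2 y2.
Proof.
rewrite (jdot_coord x1) (jdot_coord x2) mulr_suml; apply: eq_bigr => i _.
rewrite mulr_sumr; apply: eq_bigr => j _.
rewrite mulr_suml; apply: eq_bigr => k _.
rewrite mulr_sumr; apply: eq_bigr => l _.
by rewrite !mxE; ring.
Qed.

Lemma tens_tr (x y : E) : (tens x y)^T = tens y x.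
Proof. by apply/matrixP => i j; rewrite !mxE mulrC. Qed.

(* The swap x (x) y |-> y (x) x is the transposition, by [tens_tr]. *)
Definition symtensor := symmx R n.

Definition COP : set symtensor :=
  [set A | forall x, symcone J x -> 0 <= tdot A (tens x x)].

Definition frame_mx (A : symtensor) (m : nat) (c : 'I_m -> E) : 'M[R]_m :=
  \matrix_(i, j) tdot A (tens (c i) (c j)).

End Tensors.

Section InnerApproximation.
Variable R : realType.

Definition mpvar (m : nat) (i : 'I_m) : mpoly m R := mpolyX R (mnm1 i).

Definition dP_poly (m r : nat) (A : 'M[R]_m) : mpoly m R :=
  (\sum_i mpvar i) ^+ r * \sum_i \sum_j A i j *: (mpvar i * mpvar j).

Definition dP_mx (m r : nat) : set 'M[R]_m :=
  [set A | A^T = A /\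
           forall u : multinom m, 0 <= mcoeff u (dP_poly r A)].

Definition dP_tensor (E : vectType R) (J : euclideanJordan E)
    (F : set ('I_(jrank J) -> E)) (r : nat) : set (symtensor E) :=
  \bigcap_(c in F) [set A | dP_mx r (frame_mx J A c)].

End InnerApproximation.

Arguments dP_tensor {R E} J F r _.

Definition is_cone (R : realType) (V : lmodType R) (K : set V) : Prop :=
  K !=set0 /\ forall (t : R) x, 0 < t -> K x -> K (t *: x).

(* Main.v *)
(** The elements of the symmetric cone are the nonnegative combinations of the
Jordan frames, all of which have [jrank] elements, so a frame matrix in [dP_mx]
is copositive and this makes the tensor copositive. Conversely, if A is interior
to COP, then A - eps e (x) e is copositive for some eps > 0. A primitive
idempotent c satisfies e . c = |c|^2, and |c|^2 is bounded away from 0 because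
it equals |d|^2 for some d in any fixed Jordan frame. Hence the quadratic forms
of all frame matrices are at least eps' (x_1 + ... + x_rk)^2 on the nonnegative
orthant, with the same eps' > 0, and their diagonals are uniformly bounded. For
|u| = r + 2 the coefficient of x^u in (x_1 + ... + x_rk)^r x^T M x is
r!/u! (u^T M u - sum_i M_ii u_i), so one r makes it nonnegative for all
frames. *)
Require Import Defs.
From HB Require Import structures.
From mathcomp Require Import all_boot all_order all_algebra all_fingroup.
From mathcomp Require Import sesquilinear zify ring lra complex.
From mathcomp Require Import all_classical all_reals all_analysis.
From mathcomp Require Import -(notations) mpoly.

Set Implicit Arguments.
Unset Strict Implicit.
Unset Printing Implicit Defensive.

Import Order.TTheory GRing.Theory Num.Theory.
Import numFieldNormedType.Exports.

Local Open Scope classical_set_scope.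
Local Open Scope ring_scope.

(** * Jordan algebras and power associativity *)

Section JordanAlgebra.
Variables (R : realType) (E : vectType R) (J : euclideanJordan E).
Local Notation "x 'o* y" := (jmul J x y) (at level 40, left associativity).
Local Notation "<< x , y >>" := (jdot J x y).
Local Notation e := (jone J).
Implicit Types (x y z w c d : E) (a : R).

Lemma jdotC x y : << x, y >> = << y, x >>.
Proof. by rewrite hermC expr0 mul1r. Qed.

Lemma jdotDl x y z : << x + y, z >> = << x, z >> + << y, z >>.
Proof. exact: linearDl. Qed.

Lemma jdotDr x y z : << z, x + y >> = << z, x >> + << z, y >>.
Proof. exact: linearDr. Qed.

Lemma jdotNl x z : << - x, z >> = - << x, z >>.
Proof. exact: linearNl. Qed.

Lemma jdotNr x z : << z, - x >> = - << z, x >>.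
Proof. exact: linearNr. Qed.

Lemma jdotZl a x z : << a *: x, z >> = a * << x, z >>.
Proof. exact: linearZl_LR. Qed.

Lemma jdotZr a x z : << z, a *: x >> = a * << z, x >>.
Proof. exact: linearZr_LR. Qed.

Lemma jdot0l x : << 0, x >> = 0.
Proof. exact: linear0l. Qed.

Lemma jdot0r x : << x, 0 >> = 0.
Proof. exact: linear0r. Qed.

Lemma jdot_suml (I : Type) (r : seq I) (P : pred I) (f : I -> E) z :
  << \sum_(i <- r | P i) f i, z >> = \sum_(i <- r | P i) << f i, z >>.
Proof. exact: linear_sumlz. Qed.

Lemma jdot_sumr (I : Type) (r : seq I) (P : pred I) (f : I -> E) z :
  << z, \sum_(i <- r | P i) f i >> = \sum_(i <- r | P i) << z, f i >>.
Proof. exact: linear_sumr. Qed.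

Lemma jmulDl x y z : (x + y) 'o* z = x 'o* z + y 'o* z.
Proof. exact: linearDl. Qed.

Lemma jmulDr x y z : z 'o* (x + y) = z 'o* x + z 'o* y.
Proof. exact: linearDr. Qed.

Lemma jmulNl x z : (- x) 'o* z = - (x 'o* z).
Proof. exact: linearNl. Qed.

Lemma jmulNr x z : z 'o* (- x) = - (z 'o* x).
Proof. exact: linearNr. Qed.

Lemma jmulZl a x z : (a *: x) 'o* z = a *: (x 'o* z).
Proof. exact: linearZl_LR. Qed.

Lemma jmulZr a x z : z 'o* (a *: x) = a *: (z 'o* x).
Proof. exact: linearZr_LR. Qed.

Lemma jmul0r x : x 'o* 0 = 0.
Proof. exact: linear0r. Qed.

Lemma jmul_suml (I : Type) (r : seq I) (P : pred I) (f : I -> E) z :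
  (\sum_(i <- r | P i) f i) 'o* z = \sum_(i <- r | P i) (f i 'o* z).
Proof. exact: linear_sumlz. Qed.

Lemma jmul_sumr (I : Type) (r : seq I) (P : pred I) (f : I -> E) z :
  z 'o* (\sum_(i <- r | P i) f i) = \sum_(i <- r | P i) (z 'o* f i).
Proof. exact: linear_sumr. Qed.

Lemma jmul1r x : x 'o* e = x.
Proof. by rewrite jmulC jmul1l. Qed.

Lemma jdot_mulA x y z : << x 'o* y, z >> = << y, x 'o* z >>.
Proof. by rewrite jmulC jdot_assoc. Qed.

Lemma jnorm_ge0 x : 0 <= << x, x >>.
Proof.
have [->|x0] := eqVneq x 0; first by rewrite jdot0l.
by apply/ltW; exact: (@neq0_dnorm_gt0 _ _ _ (jdot J)).
Qed.

Lemma jnorm_eq0 x : << x, x >> = 0 -> x = 0.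
Proof.
move=> xx0; apply/eqP/negPn/negP => /(@neq0_dnorm_gt0 _ _ _ (jdot J)).
by rewrite xx0 ltxx.
Qed.

Lemma jdot_inj x y : (forall v, << x, v >> = << y, v >>) -> x = y.
Proof.
move=> h; apply/eqP; rewrite -subr_eq0; apply/eqP/jnorm_eq0.
by rewrite jdotDl jdotNl h subrr.
Qed.

Definition jlinE := (jmulDl, jmulDr, jmulNl, jmulNr, jmulZl, jmulZr,
  jdotDl, jdotDr, jdotNl, jdotNr, jdotZl, jdotZr).

(* The terms linear in z of the Jordan identity at x + z. *)
Lemma jordan_polar x y z :
  z 'o* (x 'o* x 'o* y) + 2 *: (x 'o* (x 'o* z 'o* y)) =
  2 *: (x 'o* z 'o* (x 'o* y)) + x 'o* x 'o* (z 'o* y).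
Proof.
apply: jdot_inj => v.
have /(congr1 (jdot J ^~ v)) := jordan_identity J (x + z) y.
have /(congr1 (jdot J ^~ v)) := jordan_identity J (x - z) y.
have /(congr1 (jdot J ^~ v)) := jordan_identity J z y.
rewrite /= !jlinE !(jmulC J z x).
lra.
Qed.

(** These are the terms linear in [w] of [jordan_polar] at [x + w]. *)
Lemma jordan_polar_full x y z w :
  z 'o* (x 'o* w 'o* y) + w 'o* (x 'o* z 'o* y) + x 'o* (w 'o* z 'o* y) =
  w 'o* z 'o* (x 'o* y) + x 'o* z 'o* (w 'o* y) + x 'o* w 'o* (z 'o* y).
Proof.
apply: jdot_inj => v.
have /(congr1 (jdot J ^~ v)) := jordan_polar (x + w) y z.
have /(congr1 (jdot J ^~ v)) := jordan_polar x y z.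
have /(congr1 (jdot J ^~ v)) := jordan_polar w y z.
rewrite /= !jlinE !(jmulC J w x).
lra.
Qed.

(** Read as an identity of operators applied to [z], the polarized Jordan identity expresses
    multiplication by a triple product through multiplications by its factors and by their pairwise
    products. *)
Lemma jmul_mul_mul x y z w :
  (x 'o* w 'o* y) 'o* z =
  x 'o* y 'o* (w 'o* z) + w 'o* y 'o* (x 'o* z) + x 'o* w 'o* (y 'o* z)
  - w 'o* (y 'o* (x 'o* z)) - x 'o* (y 'o* (w 'o* z)).
Proof.
rewrite !(jmulC J y (_ 'o* z)) (jmulC J (x 'o* y)) (jmulC J (w 'o* y)).
rewrite (jmulC J y z) (jmulC J _ z).
apply: jdot_inj => v.
have /(congr1 (jdot J ^~ v)) := jordan_polar_full x y z w.
rewrite /= !jlinE.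
lra.
Qed.

(** By [jmul_mul_mul], multiplication by x^(k+2) is a polynomial in the multiplications by x, x^2,
    x^k and x^(k+1), so commutation propagates by induction on two consecutive exponents. *)
Lemma jpow_comm (T : E -> E) x :
    additive T -> (forall y, T (x 'o* y) = x 'o* T y) ->
    (forall y, T (x 'o* x 'o* y) = x 'o* x 'o* T y) ->
  forall k y, T (jpow J x k 'o* y) = jpow J x k 'o* T y.
Proof.
move=> TB T1 T2 k.
have T0 : T 0 = 0 by have := TB 0 0; rewrite !subrr.
have TN y : T (- y) = - T y by have := TB 0 y; rewrite T0 !sub0r.
have TD y z : T (y + z) = T y + T z by rewrite -[z in LHS]opprK TB TN opprK.
suff: (forall y, T (jpow J x k 'o* y) = jpow J x k 'o* T y) /\
      (forall y, T (jpow J x k.+1 'o* y) = jpow J x k.+1 'o* T y).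
  by case.
elim: k => [|k [IH1 IH2]].
  by split=> y /=; rewrite ?jmul1r// !jmul1l.
split=> // y.
have step z : jpow J x k.+2 'o* z =
    x 'o* x 'o* (jpow J x k 'o* z) + jpow J x k.+1 'o* (x 'o* z)
    + jpow J x k.+1 'o* (x 'o* z) - jpow J x k 'o* (x 'o* (x 'o* z))
    - x 'o* (x 'o* (jpow J x k 'o* z)).
  by rewrite /= (jmulC J x (x 'o* jpow J x k)) jmul_mul_mul !(jmulC J _ x).
by rewrite !step !(TD, TN, T1, T2, IH1, IH2).
Qed.

(** Multiplications by x and x^2 commute by the Jordan identity. Hence [jpow_comm] applies to each
    of them, and what it gives are its hypotheses for multiplication by x^m. *)
Lemma jpow_jpow_comm x k m y :
  jpow J x m 'o* (jpow J x k 'o* y) = jpow J x k 'o* (jpow J x m 'o* y).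
Proof.
have addL z : additive (jmul J z) by move=> ? ?; rewrite jmulDr jmulNr.
have xm n z : x 'o* (jpow J x n 'o* z) = jpow J x n 'o* (x 'o* z).
  by apply: jpow_comm => // u; rewrite jordan_identity.
have xxm n z : x 'o* x 'o* (jpow J x n 'o* z) = jpow J x n 'o* (x 'o* x 'o* z).
  by apply: (@jpow_comm (jmul J (x 'o* x))) => // u; rewrite -jordan_identity.
by apply: jpow_comm => // u; rewrite -?xm -?xxm.
Qed.

(** Power associativity: the induction step is the commutation of multiplications by x and x^n,
    applied to x^m. *)
Lemma jpowD x m n : jpow J x (m + n) = jpow J x m 'o* jpow J x n.
Proof.
elim: m => [|m IH]; first by rewrite jmul1l.
rewrite addSn /= IH -[in LHS](jmul1r x) -[in RHS](jmul1r x).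
have := jpow_jpow_comm x n 1 (jpow J x m) => /=; rewrite jmul1r.
by rewrite (jmulC J (jpow J x m)) => ->; rewrite jmulC.
Qed.

End JordanAlgebra.

(** * Idempotents and the spectral theorem *)

Section Idempotents.
Variables (R : realType) (E : vectType R) (J : euclideanJordan E).
Local Notation "x 'o* y" := (jmul J x y) (at level 40, left associativity).
Local Notation "<< x , y >>" := (jdot J x y).
Local Notation e := (jone J).
Local Notation idem := (idempotent_elt J).
Implicit Types (x y z w c d : E).

(** Multiplication L by an idempotent satisfies L (2L - 1) (L - 1) = 0, so its only possible
    eigenvalues are the Peirce values 0, 1/2 and 1. *)
Lemma idem_cube c y : idem c ->
  2 *: (c 'o* (c 'o* (c 'o* y))) = 3 *: (c 'o* (c 'o* y)) - c 'o* y.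
Proof.
move=> cc; apply: jdot_inj => v.
have /(congr1 (jdot J ^~ v)) := jmul_mul_mul J c c y c.
rewrite !cc /= !jlinE.
lra.
Qed.

Lemma jdot_sqrB x y :
  << x - y, x - y >> = << x, x >> - 2 * << x, y >> + << y, y >>.
Proof. rewrite jdotDl !jdotDr !jdotNl !jdotNr (jdotC J y x); ring. Qed.

(** At t = 0, 1/2, 1 one has t = (2t^2 - t)^2 + 8 (t - t^2)^2. With t replaced by multiplication by
    [c], this sum of squares shows positivity without diagonalizing. *)
Lemma idem_dotE c y : idem c ->
  let u := c 'o* y in let v := c 'o* u in
  << y, u >> = << 2 *: v - u, 2 *: v - u >> + 8 * << u - v, u - v >>.
Proof.
move=> cc u v.
have w : 2 *: (c 'o* v) = 3 *: v - u by exact: idem_cube.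
have yv : << y, v >> = << u, u >> by rewrite -jdot_mulA.
have uw : << u, c 'o* v >> = << v, v >> by rewrite -jdot_mulA.
have yw : << y, c 'o* v >> = << u, v >> by rewrite -jdot_mulA.
clearbody u v.
have h1 := congr1 (jdot J u) w; rewrite !(jdotZr, jdotDr, jdotNr) uw in h1.
have h2 := congr1 (jdot J y) w; rewrite !(jdotZr, jdotDr, jdotNr) yw yv in h2.
rewrite !jdot_sqrB !jdotZl !jdotZr (jdotC J v u).
lra.
Qed.

Lemma idem_dot_ge0 c y : idem c -> 0 <= << y, c 'o* y >>.
Proof.
move=> cc; rewrite idem_dotE//.
by rewrite addr_ge0 ?jnorm_ge0// mulr_ge0// jnorm_ge0.
Qed.

(** Both squares of [idem_dotE] vanish, so L y = L^2 y and 2 L^2 y = L y, where L is multiplication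
    by [c]. *)
Lemma idem_dot_eq0 c y : idem c -> << y, c 'o* y >> = 0 -> c 'o* y = 0.
Proof.
move=> cc; rewrite idem_dotE// => h.
have := jnorm_ge0 J (2 *: (c 'o* (c 'o* y)) - c 'o* y).
have := jnorm_ge0 J (c 'o* y - c 'o* (c 'o* y)).
move=> h1 h2.
have /jnorm_eq0 e1 : << c 'o* y - c 'o* (c 'o* y), c 'o* y - c 'o* (c 'o* y) >> = 0.
  lra.
have /jnorm_eq0 e2 : << 2 *: (c 'o* (c 'o* y)) - c 'o* y,
    2 *: (c 'o* (c 'o* y)) - c 'o* y >> = 0 by lra.
move/eqP: e1; rewrite subr_eq0 => /eqP e1.
by move: e2; rewrite -e1 scaler_nat mulr2n addrK.
Qed.

Lemma idem_add_orth a b : idem a -> idem b -> idem (a + b) -> a 'o* b = 0.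
Proof.
rewrite /idempotent_elt => aa bb; rewrite jmulDl !jmulDr aa bb (jmulC J b a).
move=> h; apply: jdot_inj => v; have /(congr1 (jdot J ^~ v)) := h.
rewrite /= !jlinE jdot0l; lra.
Qed.

(** The quadratic forms of [a] and [b] at [d] are nonnegative and sum to 0, so each vanishes. *)
Lemma idem_orth_addl a b d : idem a -> idem b ->
  (a + b) 'o* d = 0 -> a 'o* d = 0.
Proof.
move=> ia ib abd; apply: idem_dot_eq0 => //.
have /(congr1 (jdot J d)) := abd; rewrite jdot0r jmulDl jdotDr.
have := idem_dot_ge0 d ia; have := idem_dot_ge0 d ib.
lra.
Qed.

Lemma jdot_idem1 c : idem c -> << c, e >> = << c, c >>.
Proof. by move=> cc; rewrite -{1}cc jdot_mulA jmul1r. Qed.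

(** This makes the Peirce 1-space of [c] closed under multiplication by its element [x]. *)
Lemma peirce1_comm c x y : idem c -> c 'o* x = x ->
  c 'o* (x 'o* y) = x 'o* (c 'o* y).
Proof.
move=> cc cx; apply: jdot_inj => v.
have /(congr1 (jdot J ^~ v)) := jordan_polar J c y x.
by rewrite !cc !cx /= !jlinE; lra.
Qed.

(** The quadratic representation P(c) = 2L^2 - L, with L multiplication by [c], has its image in the
    Peirce 1-space, by the cubic equation of L. *)
Lemma peirce1_quad c y : idem c ->
  c 'o* (2 *: (c 'o* (c 'o* y)) - c 'o* y) = 2 *: (c 'o* (c 'o* y)) - c 'o* y.
Proof.
move=> cc; rewrite jmulDr jmulNr jmulZr idem_cube//.
by apply: (@jdot_inj _ _ J) => v; rewrite !jlinE; lra.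
Qed.

End Idempotents.

(** * Evaluation of real polynomials at an element *)

Section JordanPolynomials.
Variables (R : realType) (E : vectType R) (J : euclideanJordan E).
Local Notation "x 'o* y" := (jmul J x y) (at level 40, left associativity).
Local Notation "<< x , y >>" := (jdot J x y).
Local Notation e := (jone J).
Local Notation idem := (idempotent_elt J).
Variable x : E.

Definition jpoly (p : {poly R}) : E := \sum_(i < size p) p`_i *: jpow J x i.

Lemma jpoly_widen n (p : {poly R}) : (size p <= n)%N ->
  jpoly p = \sum_(i < n) p`_i *: jpow J x i.
Proof.
move=> pn; rewrite /jpoly (big_ord_widen n (fun i => p`_i *: jpow J x i))//.
rewrite big_mkcond; apply: eq_bigr => i _; case: ltnP => // pi.
by rewrite nth_default// scale0r.
Qed.

Lemma jpoly_is_linear : linear jpoly.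
Proof.
move=> a p q; pose n := maxn (size (a *: p + q)) (maxn (size p) (size q)).
rewrite !(@jpoly_widen n) ?leq_max ?leqnn ?orbT//.
rewrite scaler_sumr -big_split; apply: eq_bigr => i _ /=.
by rewrite coefD coefZ scalerDl scalerA.
Qed.

HB.instance Definition _ :=
  GRing.isLinear.Build R {poly R} E *:%R jpoly jpoly_is_linear.

Lemma jpolyD p q : jpoly (p + q) = jpoly p + jpoly q.
Proof. exact: linearD. Qed.

Lemma jpolyZ a p : jpoly (a *: p) = a *: jpoly p.
Proof. exact: linearZ_LR. Qed.

Lemma jpoly_sum (I : Type) (r : seq I) (P : pred I) (f : I -> {poly R}) :
  jpoly (\sum_(i <- r | P i) f i) = \sum_(i <- r | P i) jpoly (f i).
Proof. exact: linear_sum. Qed.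

Lemma jpolyXn n : jpoly 'X^n = jpow J x n.
Proof.
rewrite (@jpoly_widen n.+1) ?size_polyXn// big_ord_recr/= coefXn eqxx scale1r.
by rewrite big1 ?add0r// => i _; rewrite coefXn ltn_eqF// scale0r.
Qed.

Lemma jpoly1 : jpoly 1 = e.
Proof. by rewrite -(expr0 'X) jpolyXn. Qed.

Lemma jpolyX : jpoly 'X = x.
Proof. by rewrite -(expr1 'X) jpolyXn /= jmul1r. Qed.

Lemma jpolyM p q : jpoly (p * q) = jpoly p 'o* jpoly q.
Proof.
rewrite -[p]coefK -[q]coefK !poly_def mulr_suml !jpoly_sum jmul_suml.
apply: eq_bigr => i _; rewrite mulr_sumr jpoly_sum jmul_sumr.
apply: eq_bigr => j _; rewrite -scalerAl -scalerAr !jpolyZ.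
by rewrite -exprD !jpolyXn jpowD jmulZl jmulZr.
Qed.

(** The squared norm of p(x) is the inner product of p(x)^2 with the identity. *)
Lemma jpoly_sqr_eq0 p : jpoly (p * p) = 0 -> jpoly p = 0.
Proof.
move=> h; apply: (@jnorm_eq0 _ _ J); rewrite -[X in << X, _ >>](jmul1r J).
by rewrite jdot_mulA -jpolyM h jdot0r.
Qed.

End JordanPolynomials.

(** The remainder modulo this quadratic is a real polynomial of degree at most 1 vanishing at a +
    ib. As b is nonzero, the imaginary part kills its slope, then the real part its constant
    term. *)
Lemma complex_conj_root_dvdp (R : rcfType) (p : {poly R}) (a b : R) :
  b != 0 -> root (map_poly (real_complex R) p) (a +i* b)%C ->
  ('X - a%:P) ^+ 2 + (b ^+ 2)%:P %| p.
Proof.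
move=> b0 rz; set Q := _ + _.
have sQ : size Q = 3%N.
  rewrite /Q size_polyDl ?size_exp_XsubC//.
  by rewrite (leq_ltn_trans (size_polyC_leq1 _)).
have Q0 : Q != 0 by rewrite -size_poly_gt0 sQ.
have Qz : root (map_poly (real_complex R) Q) (a +i* b)%C.
  rewrite /root rmorphD rmorphXn rmorphB /= map_polyX !map_polyC /= !hornerE.
  by apply/eqP; simpc; rewrite expr2 addNr.
rewrite /dvdp; set r := p %% Q.
have rr : root (map_poly (real_complex R) r) (a +i* b)%C.
  move: rz; rewrite (divp_eq p Q) rmorphD rmorphM /root hornerD hornerM.
  by rewrite (eqP Qz) mulr0 add0r.
have sr : (size r <= 2)%N by rewrite -ltnS -sQ ltn_modp.
have rE : r = (r`_0)%:P + r`_1 *: 'X.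
  apply/polyP => -[|[|i]]; rewrite !coefE /= ?mulr0 ?mulr1 ?addr0 ?add0r//.
  by rewrite nth_default// (leq_trans sr).
move: rr; rewrite {1}rE /root rmorphD /= map_polyZ map_polyX map_polyC /=.
rewrite !hornerE /=; simpc => /eqP[h1 h2].
have r1 : r`_1 = 0 by apply/eqP; move/eqP: h2; rewrite mulf_eq0 (negPf b0) orbF.
have r0 : r`_0 = 0 by move: h1; rewrite r1 mul0r addr0.
by rewrite rE r0 r1 scale0r addr0.
Qed.

(** * Spectral decomposition of an element *)

Section Spectral.
Variables (R : realType) (E : vectType R) (J : euclideanJordan E).
Local Notation "x 'o* y" := (jmul J x y) (at level 40, left associativity).
Local Notation "<< x , y >>" := (jdot J x y).
Local Notation e := (jone J).
Local Notation idem := (idempotent_elt J).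
Local Notation phi x := (jpoly J x).
Implicit Types (x y z w c d : E) (p q : {poly R}).

(** Translates the linear independence used in [jdegree] into the absence of nonzero annihilating
    polynomials of degree below [n]. *)
Lemma free_jpowP x n :
  reflect (forall p, (size p <= n)%N -> phi x p = 0 -> p = 0)
          (free [seq jpow J x i | i <- iota 0 n]).
Proof.
pose X := [tuple of [seq jpow J x i | i <- iota_tuple n 0]].
have XE i : (i < n)%N -> X`_i = jpow J x i.
  by move=> ni; rewrite (nth_map 0%N) ?size_iota// nth_iota.
apply: (iffP (@freeP _ _ _ X)) => h.
  move=> p pn; rewrite (jpoly_widen _ _ pn) => p0.
  apply/polyP => i; rewrite coef0; have [ni|] := ltnP i n; last first.
    by move=> ni; rewrite nth_default// (leq_trans pn).
  apply: (h (fun i : 'I_n => p`_i) _ (Ordinal ni)).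
  by rewrite -[RHS]p0; apply: eq_bigr => j _; rewrite XE.
move=> k k0 i; pose p := \poly_(i < n) oapp k 0 (insub i).
have -> : k i = p`_i by rewrite coef_poly ltn_ord valK.
rewrite (h p) ?coef0// ?size_poly// (jpoly_widen _ _ (size_poly _ _)).
rewrite -[RHS]k0; apply: eq_bigr => j _.
by rewrite coef_poly ltn_ord valK /= XE.
Qed.

(* A squarefree product of real linear factors can replace p: a double factor
   X - a is reduced by jpoly_sqr_eq0, and a factor (X - a)^2 + b^2 with b <> 0 is
   removed since phi((X - a) w)^2 + b^2 phi(w)^2 = 0 forces phi(w) = 0. *)
Lemma jpoly_split x p q : p != 0 -> phi x (p * q) = 0 ->
  exists2 s : seq R, uniq s & phi x (\prod_(a <- s) ('X - a%:P) * q) = 0.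
Proof.
have [n] := ubnP (size p); elim: n p q => // n IH p q.
rewrite ltnS => pn p0 pq0; have [p1|p1] := leqP (size p) 1.
  exists [::] => //; rewrite big_nil mul1r.
  move: pq0; rewrite (size1_polyC p1) mul_polyC jpolyZ => /eqP.
  rewrite scaler_eq0 => /orP[/eqP c0|/eqP//].
  by move: p0; rewrite (size1_polyC p1) c0 eqxx.
have [[a b] rz] : exists t, root (map_poly (real_complex R) p) t.
  by apply/closed_rootP; rewrite size_map_poly gtn_eqF.
(* The cofactor [q] serves as an accumulator: a factor [Q] is moved from [p] into it, and the
   induction runs on the smaller quotient. *)
have reduce Q : Q %| p -> (1 < size Q)%N ->
    exists2 s : seq R, uniq s & phi x (\prod_(a <- s) ('X - a%:P) * (Q * q)) = 0.
  move=> /divpK Qp sQ; have d0 : p %/ Q != 0.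
    by apply: contraNneq p0 => d0; rewrite -Qp d0 mul0r.
  apply: (IH (p %/ Q)) => //; last by rewrite mulrA Qp.
  rewrite size_divp -?size_poly_gt0 ?(ltn_trans _ sQ)//.
  by apply: leq_trans pn; rewrite ltn_subrL -subn1 subn_gt0 sQ (ltn_trans _ p1).
have [b0|b0] := eqVneq b 0; last first.
  have [|s us] := reduce _ (complex_conj_root_dvdp b0 rz).
    rewrite size_polyDl size_exp_XsubC//.
    by rewrite (leq_ltn_trans (size_polyC_leq1 _)).
  move=> s0; exists s => //; set w := _ * q.
  pose u := ('X - a%:P) * w.
  have /(congr1 (jdot J e)) : phi x (u * u + (b ^+ 2) *: (w * w)) = 0.
    rewrite -[RHS](jmul0r J (phi x w)) -s0 -jpolyM -mul_polyC; congr (phi x _).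
    by rewrite /u /w; ring.
  rewrite jpolyD jpolyZ (jpolyM _ _ u) (jpolyM _ _ w).
  rewrite jdotDr jdotZr jdot0r !(jdotC J e) !jdot_assoc !jmul1r => uw0.
  have b2 : 0 < b ^+ 2 by rewrite exprn_even_gt0.
  apply: (@jnorm_eq0 _ _ J); apply/eqP; rewrite eq_le jnorm_ge0 andbT.
  rewrite -(pmulr_rle0 _ b2); have := jnorm_ge0 J (phi x u); lra.
have dv : 'X - a%:P %| p.
  move: rz; rewrite b0 dvdp_XsubCl /root.
  have -> : (a +i* 0)%C = real_complex R a by [].
  by rewrite horner_map fmorph_eq0.
have [|s us s0] := reduce _ dv; first by rewrite size_XsubC.
have [sa|sa] := boolP (a \in s); last first.
  exists (a :: s); rewrite ?big_cons /= ?sa//.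
  by rewrite -[RHS]s0; congr (phi x _); ring.
exists s => //; move: s0; rewrite (perm_big _ (perm_to_rem sa)) big_cons /=.
set t := \prod_(_ <- _) _ => t0; apply: jpoly_sqr_eq0.
by rewrite -[RHS](jmul0r J (phi x (t * q))) -t0 -jpolyM; congr (phi x _); ring.
Qed.

(** Dependent powers of [x] give a nonzero annihilator, which [jpoly_split] turns into a product of
    distinct real linear factors. A polynomial vanishing on [s] is a multiple of that product. *)
Lemma jpoly_annihilator x : exists s : seq R,
  uniq s /\ forall p, (forall a, a \in s -> p.[a] = 0) -> phi x p = 0.
Proof.
have [p p0 xp] : exists2 p, p != 0 & phi x p = 0.
  have [k /free_jpowP h] := jdegree_subproof J x.
  apply: contra_notP h => h p _ xp; apply/eqP/negPn/negP => p0.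
  by apply: h; exists p.
have [|s us] := @jpoly_split x p 1 p0; first by rewrite mulr1.
rewrite mulr1 => s0; exists s; split=> // q qs.
have [||r ->] := @uniq_roots_prod_XsubC _ q s.
- by apply/allP => a /qs qa; apply/eqP.
- by rewrite uniq_rootsE.
by rewrite jpolyM s0 jmul0r.
Qed.

Section Lagrange.
Variables (k : nat) (a : 'I_k -> R).

Definition lagrange_poly (i : 'I_k) : {poly R} :=
  \prod_(j | j != i) ((a i - a j)^-1 *: ('X - (a j)%:P)).

Lemma horner_lagrange_poly i j : injective a ->
  (lagrange_poly i).[a j] = (i == j)%:R.
Proof.
move=> ia; rewrite /lagrange_poly horner_prod.
have [<-|ij] := eqVneq i j; last first.
  by rewrite (bigD1 j) 1?eq_sym//= !hornerE subrr mulr0 mul0r.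
rewrite big1// => l li; rewrite !hornerE mulVf// subr_eq0.
by apply: contraNneq li => /ia ->.
Qed.

End Lagrange.

(** Values at [x] depend only on the values on an annihilating set of nodes, so identities between
    Lagrange polynomials on the nodes carry over. Some idempotents may be 0, as the set of nodes
    need not be minimal. *)
Lemma jspectral x : exists k (a : 'I_k -> R) (l : 'I_k -> {poly R}),
  [/\ forall i j, phi x (l i) 'o* phi x (l j) = (i == j)%:R *: phi x (l i),
      forall i, phi x ('X * l i) = a i *: phi x (l i),
      \sum_i phi x (l i) = e & \sum_i a i *: phi x (l i) = x].
Proof.
have [s [us s0]] := jpoly_annihilator x.
pose a (i : 'I_(size s)) := s`_i.
have ia : injective a.
  by move=> i j /eqP; rewrite nth_uniq// => /eqP/val_inj.
have vanish p q : (forall i, p.[a i] = q.[a i]) -> phi x p = phi x q.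
  move=> pq; apply/eqP; rewrite -subr_eq0 -linearB; apply/eqP/s0 => t /(nthP 0).
  move=> [i si <-]; apply/eqP; rewrite !hornerE subr_eq0; apply/eqP.
  exact: (pq (Ordinal si)).
pose l := lagrange_poly a.
have lE i j : (l i).[a j] = (i == j)%:R by exact: horner_lagrange_poly.
exists (size s), a, l; split.
- move=> i j; rewrite -jpolyM -jpolyZ; apply: vanish => m.
  rewrite !hornerE !lE; have [<-|ij] := eqVneq i j; first
    by case: (i == m); rewrite ?mulr1 ?mulr0 ?mul0r.
  by have [<-|im] := eqVneq i m; rewrite ?(eq_sym j) ?(negPf ij) ?mulr0 ?mul0r.
- move=> i; rewrite -jpolyZ; apply: vanish => m; rewrite !hornerE lE.
  by have [<-//|_] := eqVneq i m; rewrite !mulr0.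
- rewrite -(jpoly1 J x) -jpoly_sum; apply: vanish => m; rewrite hornerE horner_sum.
  rewrite (bigD1 m)//= lE eqxx big1 ?addr0// => i im.
  by rewrite lE (negPf im).
- have -> : \sum_i a i *: phi x (l i) = phi x (\sum_i a i *: l i).
    by rewrite jpoly_sum; apply: eq_bigr => i _; rewrite jpolyZ.
  rewrite -[RHS](jpolyX J); apply: vanish => m; rewrite horner_sum hornerX.
  rewrite (bigD1 m)//= !hornerE lE eqxx mulr1 big1 ?addr0// => i im.
  by rewrite !hornerE lE (negPf im) mulr0.
Qed.

End Spectral.

(** * Jordan frames *)

Section Frames.
Variables (R : realType) (E : vectType R) (J : euclideanJordan E).
Local Notation "x 'o* y" := (jmul J x y) (at level 40, left associativity).
Local Notation "<< x , y >>" := (jdot J x y).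
Local Notation e := (jone J).
Local Notation idem := (idempotent_elt J).
Local Notation phi x := (jpoly J x).
Implicit Types (x y z w c d : E) (p q : {poly R}).

(** The factor ['X] excludes constant terms: they evaluate to multiples of the identity, which
    multiplication by [c] need not fix. *)
Lemma peirce1_jpoly c x p : idem c -> c 'o* x = x ->
  c 'o* phi x (p * 'X) = phi x (p * 'X).
Proof.
move=> cc cx; elim/poly_ind: p => [|p a IH].
  by rewrite mul0r /jpoly size_poly0 big_ord0 jmul0r.
rewrite [_ * 'X]mulrC jpolyM jpolyX peirce1_comm// jpolyD -[a%:P]mulr1 mul_polyC.
by rewrite jpolyZ jpoly1 !jmulDr IH !jmulZr !jmul1r (jmulC J x c) cx.
Qed.

Lemma primitive_idem_split c f : primitive_idempotent J c -> idem f ->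
  c 'o* f = f -> f = 0 \/ f = c.
Proof.
move=> [cc c0 prim] ff cf; have [->|f0] := eqVneq f 0; first by left.
have [cf0|cf0] := eqVneq (c - f) 0.
  by right; apply/eqP; rewrite eq_sym -subr_eq0 cf0.
case: prim; exists f, (c - f); split=> //; last by rewrite addrC subrK.
rewrite /idempotent_elt jmulDl !jmulDr !jmulNl !jmulNr (jmulC J f c) cf cc ff.
by rewrite subrr addr0.
Qed.

(** The Peirce 1-space of a primitive idempotent is a line: it contains the spectral idempotents of
    [x] at nonzero eigenvalues, and each of these is 0 or [c]. *)
Lemma primitive_peirce1 c x : primitive_idempotent J c -> c 'o* x = x ->
  exists a, x = a *: c.
Proof.
move=> pc cx; have [cc _ _] := pc.
have [k [a [l [lM lX _ xE]]]] := jspectral J x.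
suff /choice[t tE] i : exists t, a i *: phi x (l i) = t *: c.
  exists (\sum_i t i); rewrite scaler_suml -[LHS]xE.
  by apply: eq_bigr => i _; rewrite tE.
have [a0|a0] := eqVneq (a i) 0; first by exists 0; rewrite a0 !scale0r.
have cf : c 'o* phi x (l i) = phi x (l i).
  apply: (scalerI a0); rewrite -jmulZr -lX mulrC.
  exact: peirce1_jpoly.
have ff : idem (phi x (l i)) by rewrite /idempotent_elt lM eqxx scale1r.
by have [->|->] := primitive_idem_split pc ff cf;
  [exists 0; rewrite scaler0 scale0r|exists (a i)].
Qed.

(** P(c) y lies on the line through [c]; pairing with [c] determines the coefficient. *)
Lemma primitive_quad c y : primitive_idempotent J c ->
  2 *: (c 'o* (c 'o* y)) - c 'o* y = (<< c, y >> / << c, c >>) *: c.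
Proof.
move=> pc; have [cc c0 _] := pc.
have [a aE] := primitive_peirce1 pc (peirce1_quad y cc).
rewrite aE; congr (_ *: _).
have cc0 : << c, c >> != 0 by apply: contraNneq c0 => /jnorm_eq0 ->.
apply: (mulIf cc0); rewrite divfK// -jdotZr -aE jdotDr jdotNr jdotZr.
by rewrite -jdot_mulA cc -jdot_mulA cc; ring.
Qed.

(* Comparing the d-component of the quadratic representation P(c) d with the
   c-component of P(d) c. *)
Lemma primitive_norm_eq c d :
  primitive_idempotent J c -> primitive_idempotent J d -> << c, d >> != 0 ->
  << c, c >> = << d, d >>.
Proof.
move=> pc pd cd0.
have key u v : primitive_idempotent J u -> primitive_idempotent J v ->
    2 * << u 'o* v, u 'o* v >> - << u, v >> = << u, v >> ^+ 2 / << u, u >>.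
  move=> pu [vv _ _]; have := congr1 (jdot J v) (primitive_quad v pu).
  rewrite jdotDr jdotNr !jdotZr -!(jdot_mulA J u v) (jdot_assoc J u v v) vv.
  by rewrite (jdotC J v u) => ->; ring.
have h := key _ _ pc pd; have := key _ _ pd pc.
rewrite (jmulC J d c) (jdotC J d c) h => /(mulfI _)/invr_inj; apply.
by rewrite sqrf_eq0.
Qed.

Lemma frame_idem k (c : 'I_k -> E) i : jordan_frame J c -> c i 'o* c i = c i.
Proof. by move=> [pc _ _]; have [] := pc i. Qed.

Lemma frame_neq0 k (c : 'I_k -> E) i : jordan_frame J c -> c i != 0.
Proof. by move=> [pc _ _]; have [] := pc i. Qed.

Lemma frame_norm_neq0 k (c : 'I_k -> E) i : jordan_frame J c ->
  << c i, c i >> != 0.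
Proof.
by move=> fc; apply: contraNneq (frame_neq0 i fc) => /jnorm_eq0 ->.
Qed.

(* The matrix << c i, d j >> / << c i, c i >> is doubly stochastic. *)
Lemma frame_size_eq k m (c : 'I_k -> E) (d : 'I_m -> E) :
  jordan_frame J c -> jordan_frame J d -> k = m.
Proof.
move=> fc fd; have [pc _ sc] := fc; have [pd _ sd] := fd.
have kE : k%:R = \sum_i \sum_j << c i, d j >> / << c i, c i >>.
  rewrite -[k in k%:R]card_ord -sumr_const; apply: eq_bigr => i _.
  rewrite -mulr_suml -jdot_sumr sd jdot_idem1 ?divff ?(frame_norm_neq0 _ fc)//.
  exact: frame_idem.
have mE : m%:R = \sum_j \sum_i << c i, d j >> / << d j, d j >>.
  rewrite -[m in m%:R]card_ord -sumr_const; apply: eq_bigr => j _.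
  rewrite -mulr_suml -jdot_suml sc jdotC jdot_idem1.
    by rewrite divff ?(frame_norm_neq0 _ fd).
  exact: frame_idem.
apply/eqP; rewrite -(eqr_nat R) kE mE exchange_big /=; apply/eqP.
apply: eq_bigr => j _; apply: eq_bigr => i _.
have [->|cd0] := eqVneq << c i, d j >> 0; first by rewrite !mul0r.
by rewrite (primitive_norm_eq (pc i) (pd j) cd0).
Qed.

(** A Jordan frame with primitivity weakened to being nonzero: the stage that is refined into a
    frame by splitting. *)
Definition idem_system k (c : 'I_k -> E) : Prop :=
  [/\ forall i, idem (c i), forall i, c i != 0,
      forall i j, i != j -> c i 'o* c j = 0 & \sum_i c i = e].

Lemma idem_system_mul k (c : 'I_k -> E) (a : 'I_k -> R) j : idem_system c ->
  c j 'o* (\sum_i a i *: c i) = a j *: c j.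
Proof.
move=> [ic _ cij _]; rewrite jmul_sumr (bigD1 j)//= jmulZr ic.
by rewrite big1 ?addr0// => i ij; rewrite jmulZr cij ?scaler0// eq_sym.
Qed.

(** Multiplying a vanishing combination by one member isolates its coefficient. The bound makes the
    refinement into frames terminate. *)
Lemma idem_system_dim k (c : 'I_k -> E) : idem_system c -> (k <= \dim {:E})%N.
Proof.
move=> sc; have [_ c0 _ _] := sc.
have : free [tuple c i | i < k].
  apply/freeP => a; under eq_bigr do rewrite -tnth_nth tnth_mktuple.
  move=> /[swap] i /(congr1 (jmul J (c i))); rewrite idem_system_mul// jmul0r.
  by move=> /eqP; rewrite scaler_eq0 (negPf (c0 i)) orbF => /eqP.
move=> /eqP fc; have := dimvS (subvf <<[tuple c i | i < k]>>).
by rewrite fc size_tuple.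
Qed.

(** The half [a] replaces [c i0] and [b] takes the new index [ord0], both with the weight of [c i0].
    Each half inherits the orthogonality of [c i0] to the other members by [idem_orth_addl]. *)
Lemma idem_system_split k (c : 'I_k -> E) i0 a b (mu : 'I_k -> R) :
    idem_system c -> idem a -> idem b -> a != 0 -> b != 0 -> c i0 = a + b ->
  exists (d : 'I_k.+1 -> E) (nu : 'I_k.+1 -> R),
    idem_system d /\ \sum_i nu i *: d i = \sum_i mu i *: c i.
Proof.
move=> [ic c0 cij sc] ia ib a0 b0 cE.
pose h i := if i == i0 then a else c i.
have ab0 : a 'o* b = 0 by apply: idem_add_orth => //; rewrite -cE.
have ac i : i != i0 -> a 'o* c i = 0.
  by rewrite eq_sym => ii0; apply: (idem_orth_addl ia ib); rewrite -cE cij.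
have bc i : i != i0 -> b 'o* c i = 0.
  rewrite eq_sym => ii0; apply: (idem_orth_addl ib ia).
  by rewrite addrC -cE cij.
have hij i j : i != j -> h i 'o* h j = 0.
  rewrite /h; case: (eqVneq i i0) => [->|ii0]; case: (eqVneq j i0) => [//|ji0].
  - by move=> _; exact: ac.
  - by move=> _; rewrite jmulC ac.
  - exact: cij.
have bh i : b 'o* h i = 0.
  by rewrite /h; case: eqVneq => [_|/bc//]; rewrite jmulC.
pose d j := if unlift ord0 j is Some i then h i else b.
pose nu j := if unlift ord0 j is Some i then mu i else mu i0.
exists d, nu; split.
  split=> [j|j|j l|].
  - by rewrite /d /h; case: unliftP => // i _; case: (i == i0).
  - by rewrite /d /h; case: unliftP => // i _; case: (i == i0).
  - rewrite /d; case: unliftP => [i ->|->]; case: unliftP => [i' ->|->].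
    + by rewrite (inj_eq lift_inj); exact: hij.
    + by move=> _; rewrite jmulC bh.
    + by move=> _; rewrite bh.
    + by rewrite eqxx.
  - rewrite big_ord_recl /d unlift_none -sc (bigD1 i0)//= [in RHS](bigD1 i0)//=.
    rewrite liftK /h eqxx cE addrA (addrC b); congr (_ + _).
    by apply: eq_bigr => i /negPf ii0; rewrite liftK ii0.
rewrite big_ord_recl /d /nu unlift_none (bigD1 i0)//= [in RHS](bigD1 i0)//=.
rewrite !liftK /h eqxx cE scalerDr addrA (addrC (_ *: b)); congr (_ + _).
by apply: eq_bigr => i /negPf ii0; rewrite liftK ii0.
Qed.

Lemma idem_system_jordan_frame k (c : 'I_k -> E) (mu : 'I_k -> R) : idem_system c ->
  exists m (d : 'I_m -> E) (nu : 'I_m -> R),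
    jordan_frame J d /\ \sum_i nu i *: d i = \sum_i mu i *: c i.
Proof.
have [n] := ubnP (\dim {:E} - k)%N; elim: n k c mu => // n IH k c mu.
rewrite ltnS => kn sc; have [ic c0 cij s1] := sc.
have [[i [a [b [ia ib a0 b0 cE]]]]|prim] := pselect (exists i a b,
    [/\ idem a, idem b, a != 0, b != 0 & c i = a + b]).
  have [d [nu [sd <-]]] := idem_system_split mu sc ia ib a0 b0 cE.
  by have := idem_system_dim sd; move=> dk; apply: IH sd; lia.
exists k, c, mu; split=> //; split=> // i; split=> // -[a [b abE]].
by apply: prim; exists i, a, b.
Qed.

Lemma spectral_theorem x : exists k (c : 'I_k -> E) (mu : 'I_k -> R),
  jordan_frame J c /\ \sum_i mu i *: c i = x.
Proof.
have [k [a [l [lM _ l1 lx]]]] := jspectral J x.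
(* Only the nodes with a nonzero idempotent are kept. *)
pose A := [pred i | phi x (l i) != 0].
pose c (i : 'I_#|A|) := phi x (l (enum_val i)).
have sumE (F : 'I_k -> R) : \sum_i F i *: phi x (l i) = \sum_i F (enum_val i) *: c i.
  rewrite /c -(big_enum_val (fun i => F i *: phi x (l i))) [RHS]big_mkcond.
  by apply: eq_bigr => i _; rewrite inE; case: eqP => //= ->; rewrite scaler0.
suff sc : idem_system c.
  have [m [d [nu [fd dE]]]] := idem_system_jordan_frame (a \o enum_val) sc.
  by exists m, d, nu; split=> //; rewrite dE -lx sumE.
split=> [i|i|i j ij|].
- by rewrite /idempotent_elt lM eqxx scale1r.
- by have := enum_valP i; rewrite inE.
- by rewrite lM (inj_eq enum_val_inj) (negPf ij) scale0r.
- rewrite -l1; have := sumE (fun=> 1).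
  by under eq_bigr do rewrite scale1r; under [in RHS]eq_bigr do rewrite scale1r.
Qed.

Lemma jpoly_frame k (c : 'I_k -> E) (mu : 'I_k -> R) p : jordan_frame J c ->
  phi (\sum_i mu i *: c i) p = \sum_i p.[mu i] *: c i.
Proof.
move=> fc; have [pc cij sc] := fc.
have ic : idem_system c.
  by split=> // i; [exact: frame_idem|exact: frame_neq0].
elim/poly_ind: p => [|p a IH].
  rewrite /jpoly size_poly0 big_ord0 big1// => i _.
  by rewrite horner0 scale0r.
rewrite jpolyD jpolyM jpolyX IH -[a%:P]mulr1 mul_polyC jpolyZ jpoly1 -sc.
rewrite jmul_suml scaler_sumr -big_split; apply: eq_bigr => i _ /=.
by rewrite jmulZl idem_system_mul// scalerA -scalerDl !hornerE.
Qed.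

Lemma frame_size k (c : 'I_k -> E) : jordan_frame J c -> k = jrank J.
Proof.
move=> fc; have [pc cij sc] := fc.
have ic : idem_system c.
  by split=> // i; [exact: frame_idem|exact: frame_neq0].
apply/eqP; rewrite eqn_leq /jrank; case: ex_maxnP => r /asboolP[x <-] rmax.
apply/andP; split.
  (* The eigenvalues 0, ..., k-1 of [z] are distinct roots of every annihilator of [z], so no
     nonzero annihilator has degree below [k]. *)
  pose mu (i : 'I_k) : R := i%:R; pose z := \sum_i mu i *: c i.
  apply: leq_trans (rmax (jdegree J z) _); last by apply/asboolP; exists z.
  rewrite /jdegree; case: ex_minnP => m nf _; rewrite leqNgt; apply: contra nf.
  move=> mk; apply/free_jpowP => p pm; rewrite jpoly_frame// => p0.
  apply/eqP/negPn/negP => pn0.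
  have /(max_poly_roots pn0) : all (root p) [seq mu i | i <- enum 'I_k].
    apply/allP => _ /mapP[i _ ->]; apply/eqP.
    have := congr1 (jmul J (c i)) p0; rewrite idem_system_mul// jmul0r => /eqP.
    by rewrite scaler_eq0 (negPf (frame_neq0 i fc)) orbF => /eqP.
  rewrite size_map size_enum_ord map_inj_uniq ?enum_uniq; last first.
    by move=> i j /eqP; rewrite eqr_nat => /eqP/val_inj.
  by move=> /(_ isT); rewrite ltnNge (leq_trans pm).
(* Conversely, the element attaining the rank is a combination of a frame with [m = k] members,
   hence annihilated by the monic polynomial of degree [m] whose roots are its eigenvalues. *)
have [m [d [mu [fd <-]]]] := spectral_theorem x.
rewrite (frame_size_eq fc fd) /jdegree; case: ex_minnP => n _; apply.
apply/negP => /free_jpowP /(_ (\prod_(i < m) ('X - (mu i)%:P))).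
have -> : size (\prod_(i < m) ('X - (mu i)%:P)) = m.+1.
  by rewrite size_prod_XsubC /index_enum -enumT size_enum_ord.
move=> /(_ (leqnn _)); rewrite jpoly_frame// big1 => [/(_ erefl)/eqP|i _].
  by apply/negP/monic_neq0/monic_prod_XsubC.
by rewrite (bigD1 i)//= hornerM !hornerE subrr mul0r scale0r.
Qed.

End Frames.

(** * Coefficients of the Polya multipliers *)

Section Polya.
Variables (R : realType) (m : nat).
Implicit Types (u : multinom m) (f : mpoly m R) (A : 'M[R]_m).
Local Notation X := (@mpvar R m).

Lemma mcoeff_mpvarM i f u :
  mcoeff u (X i * f) = if u i == 0%N then 0 else mcoeff (mnm_sub u (mnm1 i)) f.
Proof.
case: eqP => [ui0|/eqP ui0]; last first.
  rewrite -[u in LHS](submK (m := mnm1 i)) ?lep1mP//.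
  by rewrite addmC mulrC mcoeffMX.
rewrite [f]mpolyE mulr_sumr raddf_sum big1// => v _.
rewrite -scalerAr /= mcoeffZ -mpolyXD mcoeffX.
case: eqP => [uE|_]; last by rewrite mulr0.
by move: ui0; rewrite -uE mnmDE mnm1E eqxx.
Qed.

Definition multinom_fact u : nat := (\prod_(i < m) (u i)`!)%N.

Lemma multinom_fact_gt0 u : (0 < multinom_fact u)%N.
Proof. by apply: prodn_gt0 => i; exact: fact_gt0. Qed.

(* The coefficient of u in the divided power basis: multiplying by a variable
   becomes a shift with a linear weight, see wcoeff_mpvarM. *)
Definition wcoeff u f : R := (multinom_fact u)%:R * mcoeff u f.

Lemma wcoeffZ u (a : R) f : wcoeff u (a *: f) = a * wcoeff u f.
Proof. by rewrite /wcoeff mcoeffZ mulrCA. Qed.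

Lemma wcoeff_sum u (f : 'I_m -> mpoly m R) :
  wcoeff u (\sum_i f i) = \sum_i wcoeff u (f i).
Proof. by rewrite /wcoeff raddf_sum mulr_sumr. Qed.

Lemma wcoeff_mpvarM i f u :
  wcoeff u (X i * f) = (u i)%:R * wcoeff (mnm_sub u (mnm1 i)) f.
Proof.
rewrite /wcoeff mcoeff_mpvarM; case: eqP => [->|/eqP ui0].
  by rewrite mul0r mulr0.
rewrite mulrA -natrM; congr (_%:R * _).
rewrite /multinom_fact (bigD1 i)//= [in RHS](bigD1 i)//= mulnA.
rewrite mnmBE mnm1E eqxx subn1 -{1}(prednK (n := u i)) ?lt0n// factS.
rewrite prednK ?lt0n//; congr (_ * _)%N; apply: eq_bigr => j ji.
by rewrite mnmBE mnm1E eq_sym (negPf ji) subn0.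
Qed.

Lemma mdeg_sub1 u i : u i != 0%N -> (mdeg (mnm_sub u (mnm1 i))).+1 = mdeg u.
Proof.
move=> ui0; rewrite -[in RHS](submK (m := mnm1 i) (m' := u)) ?lep1mP//.
by rewrite mdegD mdeg1 addn1.
Qed.

(** The multinomial theorem: in the induction step the weights [u i] of the shifts add up to the
    degree r + 1. *)
Lemma wcoeff_pow r u :
  wcoeff u ((\sum_i X i) ^+ r) = (mdeg u == r)%:R * r`!%:R.
Proof.
elim: r u => [|r IH] u.
  rewrite expr0 /wcoeff mcoeff1 -mdeg_eq0; case: eqP => [|_]; last first.
    by rewrite mulr0 mul0r.
  move/eqP; rewrite mdeg_eq0 => /eqP ->; rewrite /multinom_fact.
  by rewrite big1// => i _; rewrite mnm0E.
have -> : wcoeff u ((\sum_i X i) ^+ r.+1) =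
    \sum_i (u i)%:R * ((mdeg u == r.+1)%:R * r`!%:R).
  rewrite exprS mulr_suml wcoeff_sum.
  apply: eq_bigr => i _; rewrite wcoeff_mpvarM IH.
  have [->|ui0] := eqVneq (u i) 0%N; first by rewrite !mul0r.
  by rewrite -(mdeg_sub1 ui0) eqSS.
rewrite -mulr_suml -natr_sum -mdegE factS natrM mulrCA.
by case: eqP => [->|_]; rewrite ?mul0r.
Qed.

(** Shifting by X_i and then by X_j produces the weight u_i (u_j - [i = j]); the bracket accounts
    for the diagonal sum. *)
Lemma wcoeff_dP_poly r A u : wcoeff u (dP_poly r A) =
  (mdeg u == r.+2)%:R * r`!%:R *
  (\sum_i \sum_j A i j * (u i)%:R * (u j)%:R - \sum_i A i i * (u i)%:R).
Proof.
have XX i j : wcoeff u (X i * (X j * (\sum_i X i) ^+ r)) =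
    (mdeg u == r.+2)%:R * r`!%:R * ((u i)%:R * ((u j)%:R - (i == j)%:R)).
  rewrite !wcoeff_mpvarM wcoeff_pow mnmBE mnm1E.
  have [->|ui0] := eqVneq (u i) 0%N; first by rewrite !(mul0r, mulr0).
  rewrite natrB; last by case: eqP => // <-; rewrite lt0n.
  (* If the shifted exponent is 0, the weight makes both sides vanish. Otherwise both shifts lower
     the degree by exactly 1. *)
  have [vj0|vj0] := eqVneq (mnm_sub u (mnm1 i) j) 0%N.
    have -> : (u j)%:R - (i == j)%:R = 0 :> R.
      rewrite -natrB; last by case: eqP => // <-; rewrite lt0n.
      by rewrite -mnm1E -mnmBE vj0.
    by rewrite !(mul0r, mulr0).
  by rewrite -(mdeg_sub1 ui0) -(mdeg_sub1 vj0) !eqSS mulrA mulrC.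
have -> : dP_poly r A =
    \sum_i \sum_j A i j *: (X i * (X j * (\sum_i X i) ^+ r)).
  rewrite /dP_poly mulr_sumr; apply: eq_bigr => i _.
  rewrite mulr_sumr; apply: eq_bigr => j _.
  by rewrite -scalerAr mulrC mulrA.
rewrite wcoeff_sum -sumrB mulr_sumr; apply: eq_bigr => i _.
have -> : A i i * (u i)%:R = \sum_j A i j * (u i)%:R * (i == j)%:R.
  rewrite (bigD1 i)//= eqxx mulr1 big1 ?addr0// => j ji.
  by rewrite eq_sym (negPf ji) mulr0.
rewrite wcoeff_sum -sumrB mulr_sumr; apply: eq_bigr => j _.
by rewrite wcoeffZ XX; ring.
Qed.

(** For |u| = r + 2 the diagonal sum is at most M |u| <= eps |u|^2, which the quadratic form
    dominates. *)
Lemma polya_criterion r A (eps M : R) :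
    (forall u,
      eps * (mdeg u)%:R ^+ 2 <= \sum_i \sum_j A i j * (u i)%:R * (u j)%:R) ->
    (forall i, A i i <= M) -> M <= eps * r.+2%:R ->
  forall u, 0 <= mcoeff u (dP_poly r A).
Proof.
move=> hA hM Mr u.
rewrite -(pmulr_rge0 (x := (multinom_fact u)%:R)); last first.
  by rewrite ltr0n multinom_fact_gt0.
rewrite -[X in 0 <= X]/(wcoeff u _) wcoeff_dP_poly.
case: eqP => [ur|_]; last by rewrite !mul0r.
rewrite mul1r mulr_ge0// subr_ge0; apply: le_trans (hA u).
apply: (@le_trans _ _ (\sum_i M * (u i)%:R)).
  by apply: ler_sum => i _; apply: ler_wpM2r.
by rewrite -mulr_sumr -natr_sum -mdegE expr2 mulrA ler_wpM2r// ur.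
Qed.

(** One more factor x_1 + ... + x_m turns each coefficient into a sum of earlier coefficients. *)
Lemma dP_mx_leS r : @dP_mx R m r `<=` dP_mx r.+1.
Proof.
move=> A [AT A0]; split=> // u.
rewrite /dP_poly exprS -mulrA mulr_suml raddf_sum.
by apply: sumr_ge0 => i _; rewrite /= mcoeff_mpvarM; case: eqP => // _; exact: A0.
Qed.

Lemma dP_mx_copositive r A (x : 'I_m -> R) : dP_mx r A -> (forall i, 0 <= x i) ->
  0 <= \sum_i \sum_j A i j * (x i * x j).
Proof.
move=> [_ A0] x0; have sx0 : 0 <= \sum_i x i by exact: sumr_ge0.
have : 0 <= (\sum_i x i) ^+ r * \sum_i \sum_j A i j * (x i * x j).
  have <- : meval x (dP_poly r A) =
      (\sum_i x i) ^+ r * \sum_i \sum_j A i j * (x i * x j).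
    rewrite /dP_poly rmorphM rmorphXn !rmorph_sum /=; congr (_ ^+ _ * _).
      by apply: eq_bigr => i _; rewrite mevalXU.
    apply: eq_bigr => i _; rewrite rmorph_sum; apply: eq_bigr => j _ /=.
    by rewrite mevalZ mevalM !mevalXU.
  rewrite mevalE sumr_ge0// => u _; rewrite mulr_ge0// prodr_ge0// => i _.
  by rewrite exprn_ge0.
(* A positive sum of coordinates can be cancelled; a zero sum forces all coordinates to be 0. *)
have [sx|sx] := eqVneq (\sum_i x i) 0; last first.
  by rewrite pmulr_rge0// exprn_gt0// lt_def sx.
move=> _; have xi0 i : x i = 0.
  by move/eqP: sx; rewrite psumr_eq0// => /allP/(_ i (mem_index_enum i))/eqP.
by rewrite sumr_ge0// => i _; rewrite sumr_ge0// => j _; rewrite xi0 mul0r mulr0.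
Qed.

End Polya.

(** * Symmetric tensors *)

Lemma continuous_sum_scale (R : realType) (T : topologicalType) (k : nat)
    (f : 'I_k -> T -> R) (a : 'I_k -> R) :
  (forall i, continuous (f i)) -> continuous (fun x => \sum_i f i x * a i).
Proof.
move=> fc; apply: continuous_big; first exact: add_continuous.
by move=> i _ x; apply: cvgM; [exact: fc|exact: cvg_cst].
Qed.

Section SymTensors.
Variables (R : realType) (E : vectType R) (J : euclideanJordan E).
Local Notation "x 'o* y" := (jmul J x y) (at level 40, left associativity).
Local Notation "<< x , y >>" := (jdot J x y).
Local Notation e := (jone J).
Local Notation n := (\dim {:E}).
Local Notation b := (vbasis {:E}).
Implicit Types (x y z c d : E) (A : symtensor E).

Lemma tdotE (M : 'M[R]_n) x y : tdot J M (tens x y) =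
  \sum_i \sum_j M i j * (<< b`_i, x >> * << b`_j, y >>).
Proof.
have bE i z : << b`_i, z >> = \sum_k coord b k z * << b`_i, b`_k >>.
  rewrite {1}(coord_vbasis (memvf z)) jdot_sumr.
  by apply: eq_bigr => k _; rewrite jdotZr.
apply: eq_bigr => i _; apply: eq_bigr => j _.
rewrite (bE i x) (bE j y) mulr_suml mulr_sumr; apply: eq_bigr => k _.
rewrite !mulr_sumr; apply: eq_bigr => l _.
by rewrite mxE; ring.
Qed.

Lemma tdotC A x y : tdot J A (tens x y) = tdot J A (tens y x).
Proof.
have AT i j : A i j = A j i.
  by case: A => M /= /eqP MT; rewrite -[in LHS]MT mxE.
rewrite !tdotE exchange_big; apply: eq_bigr => i _; apply: eq_bigr => j _.
by rewrite AT; ring.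
Qed.

Lemma tdotD (M N : 'M[R]_n) x y :
  tdot J (M + N) (tens x y) = tdot J M (tens x y) + tdot J N (tens x y).
Proof.
rewrite !tdotE -big_split; apply: eq_bigr => i _ /=.
by rewrite -big_split; apply: eq_bigr => j _; rewrite mxE mulrDl.
Qed.

Lemma tdotZ (a : R) (M : 'M[R]_n) x y :
  tdot J (a *: M) (tens x y) = a * tdot J M (tens x y).
Proof.
rewrite !tdotE mulr_sumr; apply: eq_bigr => i _.
by rewrite mulr_sumr; apply: eq_bigr => j _; rewrite mxE mulrA.
Qed.

Lemma tdot_sum k (c : 'I_k -> E) (a : 'I_k -> R) (M : 'M[R]_n) :
  tdot J M (tens (\sum_i a i *: c i) (\sum_i a i *: c i)) =
  \sum_i \sum_j tdot J M (tens (c i) (c j)) * (a i * a j).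
Proof.
transitivity (\sum_i a i * tdot J M (tens (c i) (\sum_i a i *: c i))).
  rewrite tdotE; under eq_bigr do under eq_bigr do rewrite jdot_sumr.
  under eq_bigr do under eq_bigr do rewrite mulr_suml mulr_sumr.
  under eq_bigr do rewrite exchange_big /=.
  rewrite exchange_big; apply: eq_bigr => l _; rewrite tdotE mulr_sumr /=.
  apply: eq_bigr => i _; rewrite mulr_sumr; apply: eq_bigr => j _.
  by rewrite jdotZr; ring.
apply: eq_bigr => i _.
transitivity (\sum_j a i * (a j * tdot J M (tens (c i) (c j)))); last first.
  by apply: eq_bigr => j _; ring.
rewrite -mulr_sumr; congr (_ * _).
rewrite tdotE; under eq_bigr do under eq_bigr do rewrite jdot_sumr.
under eq_bigr do under eq_bigr do rewrite !mulr_sumr.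
under eq_bigr do rewrite exchange_big /=.
rewrite exchange_big; apply: eq_bigr => l _; rewrite tdotE mulr_sumr /=.
apply: eq_bigr => i' _; rewrite mulr_sumr; apply: eq_bigr => j _.
by rewrite jdotZr; ring.
Qed.

Lemma frame_mx_tr A k (c : 'I_k -> E) : (frame_mx J A c)^T = frame_mx J A c.
Proof. by apply/matrixP => i j; rewrite !mxE tdotC. Qed.

Lemma symmx_val_continuous : continuous (@symmx_val R n).
Proof. exact: initial_continuous. Qed.

Lemma tdot_continuous x y :
  continuous (fun A : symtensor E => tdot J A (tens x y)).
Proof.
have -> : (fun A : symtensor E => tdot J A (tens x y)) = fun A : symtensor E =>
    \sum_i (\sum_j A i j * << b`_j, y >>) * << b`_i, x >>.
  apply/funext => A; rewrite tdotE; apply: eq_bigr => i _.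
  by rewrite mulr_suml; apply: eq_bigr => j _; ring.
apply: continuous_sum_scale => i; apply: continuous_sum_scale => j A.
apply: (@continuous_comp _ _ _ (@symmx_val R n) (fun M : 'M[R]_n => M i j)).
  exact: symmx_val_continuous.
exact: coord_continuous.
Qed.

Lemma symcone_frame k (c : 'I_k -> E) (a : 'I_k -> R) : jordan_frame J c ->
  (forall i, 0 <= a i) -> symcone J (\sum_i a i *: c i).
Proof.
move=> fc a0; exists (\sum_i Num.sqrt (a i) *: c i) => //.
(* The square is put into the form of [jpow] at 2, which ends in the identity, so that it becomes
   the value of X^2 and is computed on eigenvalues. *)
rewrite -[X in _ 'o* X](jmul1r J) -[LHS]/(jpow J _ 2) -jpolyXn jpoly_frame//.
by apply: eq_bigr => i _; rewrite hornerXn sqr_sqrtr.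
Qed.

Lemma primitive_norm_lb : exists2 r : R, 0 < r &
  forall c, primitive_idempotent J c -> r <= << c, c >>.
Proof.
have [k [d [_ [fd _]]]] := spectral_theorem J 0; have [pd _ sd] := fd.
(* The inverse of [S] is below every squared norm in the frame; the summand 1 keeps [S] positive
   even for the empty frame of the zero algebra. *)
pose S := 1 + \sum_j << d j, d j >>^-1.
have inv_ge0 j : 0 <= << d j, d j >>^-1 by rewrite invr_ge0 jnorm_ge0.
have S0 : 0 < S by rewrite ltr_pwDl// sumr_ge0.
exists S^-1; first by rewrite invr_gt0.
move=> c pc; have [cc c0 _] := pc.
have cn : << c, c >> != 0 by apply: contraNneq c0 => /jnorm_eq0 ->.
have [j cj] : exists j, << c, d j >> != 0.
  apply/existsP; apply: contraNT cn; rewrite negb_exists => /forallP h.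
  rewrite -jdot_idem1// -sd jdot_sumr big1// => j _.
  by apply/eqP; move: (h j); rewrite negbK.
have dj : 0 < << d j, d j >> by rewrite lt_def jnorm_ge0 frame_norm_neq0.
rewrite (primitive_norm_eq pc (pd j) cj) -[leRHS]invrK lef_pV2 ?posrE ?invr_gt0//.
rewrite /S (bigD1 j)//= addrCA lerDl addr_ge0//.
by apply: sumr_ge0.
Qed.

(** Since e . c = |c|^2, the difference of the two sides is |e - c|^2. *)
Lemma idem_norm_ub c : idempotent_elt J c -> << c, c >> <= << e, e >>.
Proof.
move=> cc; have := jnorm_ge0 J (e - c).
rewrite jdot_sqrB (jdotC J e c) jdot_idem1//; lra.
Qed.

Lemma tdot_idem_ub A : exists2 M : R, 0 <= M &
  forall c, idempotent_elt J c -> tdot J A (tens c c) <= M.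
Proof.
pose K := \sum_(i < n) << b`_i, b`_i >> + << e, e >>.
have K0 : 0 <= K by rewrite addr_ge0 ?jnorm_ge0 ?sumr_ge0// => i _; exact: jnorm_ge0.
have bK (i : 'I_n) c : idempotent_elt J c -> `|<< b`_i, c >>| <= K.
  move=> /idem_norm_ub cK.
  have bi : << b`_i, b`_i >> <= \sum_(i < n) << b`_i, b`_i >>.
    by rewrite (bigD1 i)//= lerDl sumr_ge0// => j _; exact: jnorm_ge0.
  (* Expanding both squared norms bounds twice the absolute inner product by the sum of the two
     squared norms. *)
  have := jnorm_ge0 J (b`_i - c); have := jnorm_ge0 J (b`_i + c).
  rewrite jdot_sqrB jdotDl !jdotDr (jdotC J c b`_i) ler_norml.
  have := jnorm_ge0 J b`_i; have := jnorm_ge0 J c.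
  rewrite /K; move: (\sum_(i < n) _) bi => s bi ? ? ? ?.
  by apply/andP; split; lra.
exists (\sum_i \sum_j `|A i j| * (K * K)).
  by apply: sumr_ge0 => i _; apply: sumr_ge0 => j _; rewrite !mulr_ge0.
move=> c ic; rewrite tdotE; apply: ler_sum => i _; apply: ler_sum => j _.
by rewrite (le_trans (ler_norm _))// !normrM ler_wpM2l// ler_pM// bK.
Qed.

Lemma interior_COP_sub A : (COP J)° A -> exists2 eps : R, 0 < eps &
  forall x, symcone J x -> eps * << e, x >> ^+ 2 <= tdot J A (tens x x).
Proof.
move=> Aint.
have eeP : tens e e \in @symmx_pred R n by rewrite unfold_in; apply/eqP/tens_tr.
pose B : symtensor E := SymMx eeP.
have ctn : continuous (fun t : R => (A - t *: B : symtensor E)).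
  apply: continuous_comp_initial => t.
  apply: (@cvgB _ _ _ _ _ (fun=> symmx_val A) (fun t => t *: symmx_val B)).
    exact: cvg_cst.
  exact: scalel_continuous.
have : nbhs (0 : R) ((fun t : R => (A - t *: B : symtensor E)) @^-1` (COP J)).
  by apply: ctn; rewrite scale0r subr0.
move=> /nbhs_ballP[eps /= eps0 epsP].
(* Half of the radius lies inside the open ball. *)
exists (eps / 2); first by rewrite divr_gt0.
move=> x xJ; have : COP J (A - (eps / 2) *: B).
  apply: epsP; rewrite /ball /= sub0r normrN gtr0_norm ?divr_gt0//.
  by rewrite ltr_pdivrMr// ltr_pMr// ltr1n.
move=> /(_ x xJ).
rewrite -scaleNr [symmx_val _]/= tdotD tdotZ tdot_tens -expr2 mulNr.
by rewrite subr_ge0.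
Qed.

End SymTensors.

(** * The inner approximations: convexity, closedness and inclusions *)

Section DPTensors.
Variables (R : realType) (E : vectType R) (J : euclideanJordan E).
Local Notation n := (\dim {:E}).
Implicit Types (A B : symtensor E) (c : 'I_(jrank J) -> E).
Implicit Types F : set ('I_(jrank J) -> E).

(** The coefficients are linear forms in the matrix entries; convexity, the cone property and
    closedness all rest on this. *)
Lemma mcoeff_dP_poly m r (M : 'M[R]_m) (u : multinom m) :
  mcoeff u (dP_poly r M) =
  \sum_i \sum_j M i j *
    mcoeff u ((\sum_i mpvar R i) ^+ r * (mpvar R i * mpvar R j)).
Proof.
rewrite /dP_poly mulr_sumr raddf_sum; apply: eq_bigr => i _ /=.
rewrite mulr_sumr raddf_sum; apply: eq_bigr => j _ /=.
by rewrite -scalerAr mcoeffZ.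
Qed.

Lemma dP_tensorP F r A : dP_tensor J F r A <->
  forall c u, F c -> 0 <= mcoeff u (dP_poly r (frame_mx J A c)).
Proof.
split=> [AF c u /AF[]//|AF c Fc]; split; first exact: frame_mx_tr.
by move=> u; exact: AF.
Qed.

Lemma mcoeff_frame_mxD r c u A B :
  mcoeff u (dP_poly r (frame_mx J (A + B) c)) =
  mcoeff u (dP_poly r (frame_mx J A c)) + mcoeff u (dP_poly r (frame_mx J B c)).
Proof.
rewrite !mcoeff_dP_poly -big_split; apply: eq_bigr => i _ /=.
rewrite -big_split; apply: eq_bigr => j _ /=.
by rewrite !mxE tdotD mulrDl.
Qed.

Lemma mcoeff_frame_mxZ r c u a A :
  mcoeff u (dP_poly r (frame_mx J (a *: A) c)) =
  a * mcoeff u (dP_poly r (frame_mx J A c)).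
Proof.
rewrite !mcoeff_dP_poly mulr_sumr; apply: eq_bigr => i _ /=.
rewrite mulr_sumr; apply: eq_bigr => j _ /=.
by rewrite !mxE tdotZ [RHS]mulrA.
Qed.

Lemma dP_tensorD F r A B :
  dP_tensor J F r A -> dP_tensor J F r B -> dP_tensor J F r (A + B).
Proof.
move=> /dP_tensorP hA /dP_tensorP hB; apply/dP_tensorP => c u Fc.
by rewrite mcoeff_frame_mxD; apply: addr_ge0; [exact: hA|exact: hB].
Qed.

Lemma dP_tensorZ F r a A : 0 <= a -> dP_tensor J F r A -> dP_tensor J F r (a *: A).
Proof.
move=> a0 /dP_tensorP hA; apply/dP_tensorP => c u Fc.
by rewrite mcoeff_frame_mxZ; apply: mulr_ge0; [|exact: hA].
Qed.

Lemma dP_tensor_convex F r : convex_set (dP_tensor J F r).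
Proof.
move=> A B t /set_mem hA /set_mem hB; apply/mem_set.
have hAB : dP_tensor J F r
    (t%:num *: (A : symtensor E) + (1 - t%:num) *: (B : symtensor E)).
  by apply: dP_tensorD; apply: dP_tensorZ => //; rewrite subr_ge0.
exact: hAB.
Qed.

Lemma dP_tensor_cone F r : is_cone (dP_tensor J F r).
Proof.
split; last by move=> t A /ltW; exact: dP_tensorZ.
exists 0; apply/dP_tensorP => c u _.
by rewrite -[0 : symtensor E](scale0r 0) mcoeff_frame_mxZ mul0r.
Qed.

Lemma dP_tensor_closed F r : closed (dP_tensor J F r).
Proof.
have -> : dP_tensor J F r = \bigcap_(c in F) \bigcap_(u in [set: multinom _])
    (fun A : symtensor E => mcoeff u (dP_poly r (frame_mx J A c)))
      @^-1` [set x | 0 <= x].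
  apply/seteqP; split=> A.
    by move=> /dP_tensorP hA c Fc u _; exact: hA.
  by move=> hA; apply/dP_tensorP => c u Fc; exact: hA.
apply: closed_bigI => c _; apply: closed_bigI => u _.
apply: (proj1 (continuous_closedP _)); last exact: closed_ge.
have -> : (fun A : symtensor E => mcoeff u (dP_poly r (frame_mx J A c))) =
    fun A => \sum_i \sum_j tdot J A (tens (c i) (c j)) *
    mcoeff u ((\sum_i mpvar R i) ^+ r * (mpvar R i * mpvar R j)).
  apply/funext => A; rewrite mcoeff_dP_poly; apply: eq_bigr => i _.
  by apply: eq_bigr => j _; rewrite mxE.
apply: continuous_big => [|i _]; first exact: add_continuous.
apply: continuous_sum_scale => j; exact: tdot_continuous.
Qed.

Lemma dP_tensor_leS F r : dP_tensor J F r `<=` dP_tensor J F r.+1.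
Proof. by move=> A hA c Fc; apply: dP_mx_leS; exact: hA. Qed.

(** Permuting a frame only permutes the eigenvalues, so the frame can be replaced by the
    representative of its orbit. *)
Lemma spectral_representative Fc x : complete_representatives J Fc ->
  exists c (mu : 'I_(jrank J) -> R),
    [/\ Fc c, jordan_frame J c & \sum_i mu i *: c i = x].
Proof.
move=> [Fcf Fcr]; have [k [c [mu [fc <-]]]] := spectral_theorem J x.
have kE := frame_size fc; subst k.
have [c' [[Fc' [s sE]] _]] := Fcr c fc.
exists c', (mu \o s); split=> //; first exact: Fcf.
by rewrite sE [RHS](reindex_inj (@perm_inj _ s)).
Qed.

(** In a representative frame that diagonalizes y, the square of y has the nonnegative coordinates
    mu_i^2, at which the copositive frame matrix is evaluated. *)
Lemma dP_tensor_sub_COP Fc F r : complete_representatives J Fc -> Fc `<=` F ->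
  dP_tensor J F r `<=` COP J.
Proof.
move=> hFc FcF A hA _ [y _ <-].
have [c [mu [cFc fc <-]]] := spectral_representative y hFc.
rewrite -[X in jmul J _ X](jmul1r J) -[X in tens X _]/(jpow J _ 2).
rewrite -[X in tens _ X]/(jpow J _ 2) -jpolyXn jpoly_frame// tdot_sum.
have := dP_mx_copositive (hA c (FcF _ cFc)).
move=> /(_ (fun i => 'X^2.[mu i])); under eq_bigr do under eq_bigr do rewrite mxE.
by apply=> i; rewrite hornerXn sqr_ge0.
Qed.

Lemma interior_COP_sub_dP_tensor F : F `<=` ordered_frames J ->
  (COP J)° `<=` \bigcup_r dP_tensor J F r.
Proof.
move=> FJ A /interior_COP_sub[eps eps0 hA].
have [M M0 hM] := tdot_idem_ub J A; have [d d0 hd] := primitive_norm_lb J.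
have ed0 : 0 < eps * d ^+ 2 by rewrite mulr_gt0// exprn_gt0.
(* The constants [M], [eps] and [d] are independent of the frame, hence so is this Archimedean
   choice of [r]. *)
pose r := Num.bound (M / (eps * d ^+ 2)).
exists r => // c Fc; have fc := FJ _ Fc; have [pc _ _] := fc.
split; first exact: frame_mx_tr.
apply: (@polya_criterion _ _ _ _ (eps * d ^+ 2) M).
(* The exponents of [u] are used as coordinates of a cone element x in the frame; then e . x is the
   sum of u_i |c_i|^2, hence at least d |u|. *)
- move=> u; pose a i : R := (u i)%:R.
  have a0 i : 0 <= a i by rewrite ler0n.
  have := hA _ (symcone_frame fc a0); rewrite tdot_sum.
  have -> : \sum_i \sum_j frame_mx J A c i j * (u i)%:R * (u j)%:R =
      \sum_i \sum_j tdot J A (tens (c i) (c j)) * (a i * a j).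
    by apply: eq_bigr => i _; apply: eq_bigr => j _; rewrite mxE mulrA.
  apply: le_trans; rewrite -mulrA -exprMn ler_wpM2l ?(ltW eps0)//.
  rewrite ler_sqr ?nnegrE ?mulr_ge0 ?(ltW d0)//; last first.
    rewrite jdot_sumr sumr_ge0// => i _; rewrite jdotZr mulr_ge0//.
    by rewrite jdotC jdot_idem1 ?jnorm_ge0//; exact: frame_idem.
  rewrite jdot_sumr mdegE natr_sum mulr_sumr; apply: ler_sum => i _.
  rewrite jdotZr mulrC ler_wpM2l// jdotC jdot_idem1 ?hd//.
  exact: frame_idem.
- by move=> i; rewrite mxE hM//; exact: frame_idem.
- rewrite mulrC -ler_pdivrMr//.
  have /ltW/le_trans := archi_boundP (divr_ge0 M0 (ltW ed0)); apply.
  by rewrite ler_nat -/r; lia.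
Qed.

End DPTensors.

Theorem proposition4p7 (R : realType) (E : vectType R) (J : euclideanJordan E)
    (Fc F : set ('I_(jrank J) -> E))
    (hFc : complete_representatives J Fc)
    (hFcF : Fc `<=` F) (hF : F `<=` ordered_frames J) :
  [/\ forall r : nat,
        [/\ closed (dP_tensor J F r), convex_set (dP_tensor J F r)
          & is_cone (dP_tensor J F r)],
      forall r : nat,
        dP_tensor J F r `<=` dP_tensor J F r.+1 /\ dP_tensor J F r.+1 `<=` COP J
    & (COP J)° `<=` \bigcup_r dP_tensor J F r].
Proof.
split; first by move=> r; split;
  [exact: dP_tensor_closed|exact: dP_tensor_convex|exact: dP_tensor_cone].
- by move=> r; split; [exact: dP_tensor_leS|exact: dP_tensor_sub_COP hFc hFcF].
- exact: interior_COP_sub_dP_tensor.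
Qed.
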